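(* Let $c=(c_1,\dots,c_k)$ be a composition of $n$. Then all coefficients of the reduced composition polynomial $f_c(q)=g_c(q)/(1-q)^k$ (a polynomial of degree $n-k$) are positive; i.e. writing $f_c(q)=\sum_{i=0}^{n-k} f_i q^i$, we have $f_i>0$ for all $0\le i\le n-k$.
   Context: For a composition $c=(c_1,\dots,c_k)$ of $n$ (positive integers summing to $n$), the composition polynomial is \[ g_c(q) := \int_{q}^{1} \int_{q}^{t_k} \cdots \int_{q}^{t_2} t_1^{c_1-1}\cdots t_k^{c_k-1}\, dt_1\cdots dt_k , \] and $f_c(q)=g_c(q)/(1-q)^k$, which is a polynomial of degree $n-k$. *)

(* Defs.v *)
From Stdlib Require Import Reals List.
From Coquelicot Require Import Coquelicot.
Import ListNotations.
Open Scope R_scope.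

Definition is_composition (c : list nat) (n : nat) : Prop :=
  List.Forall (fun ci => (0 < ci)%nat) c /\ list_sum c = n.

(** [iterated_integral q [c_j; ...; c_1] T w] is
      int_q^T int_q^(t_j) ... int_q^(t_2)
        t_1^(c_1-1) ... t_j^(c_j-1) * w  dt_1 ... dt_j.
    The parts are listed from the outermost variable to the innermost one, and
    [w] accumulates the monomial in the variables that are already bound, so
    that the whole product is the integrand of the innermost integral. *)
Fixpoint iterated_integral (q : R) (rc : list nat) (T w : R) : R :=
  match rc with
  | [] => w
  | cj :: rc' =>
      RInt (fun t => iterated_integral q rc' t (t ^ (cj - 1) * w)) q T
  end.

(** [g_c(q)]. [RInt] is the oriented integral, so every real [q] is allowed. *)
Definition composition_poly (c : list nat) (q : R) : R :=
  iterated_integral q (rev c) 1 1.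

(** [f_c(q)], meaningful for [q <> 1]. *)
Definition reduced_composition_poly (c : list nat) (q : R) : R :=
  composition_poly c q / (1 - q) ^ length c.

(** [f 0, ..., f d] are the coefficients of a polynomial that agrees with
    [f_c] wherever the quotient [g_c(q) / (1-q)^k] is defined. This determines
    [f 0, ..., f d]; the values [f i] for [i > d] are irrelevant. *)
Definition reduced_composition_coeffs
    (c : list nat) (d : nat) (f : nat -> R) : Prop :=
  forall q : R, q <> 1 ->
    reduced_composition_poly c q = sum_f_R0 (fun i => f i * q ^ i) d.

(* Main.v *)
(** Substituting [t_j = q + (1 - q) s_j] turns [g_c(q)] into [(1 - q)^k] times the
    integral of [prod_j (q (1 - s_j) + s_j)^(c_j - 1)] over the simplex
    [0 <= s_1 <= ... <= s_k <= 1]. In the interior of the simplex this integrand is a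
    polynomial in [q] of degree [n - k] whose coefficients are all positive, and
    integration preserves positivity. *)
Require Import Defs.
From Stdlib Require Import Reals List Lra Lia.
From Coquelicot Require Import Coquelicot.
Open Scope R_scope.

Lemma continuous_sum_f_R0 (F : nat -> R -> R) (d : nat) (x : R) :
  (forall i, continuous (F i) x) ->
  continuous (fun y => sum_f_R0 (fun i => F i y) d) x.
Proof.
  intros HF; induction d as [|d IH]; simpl; [apply HF|].
  exact (continuous_plus (V := R_NormedModule) _ _ _ IH (HF (S d))).
Qed.

Lemma continuous_Rpow (f : R -> R) (n : nat) (x : R) :
  continuous f x -> continuous (fun y => f y ^ n) x.
Proof.
  intros Hf; induction n as [|n IH]; simpl; [apply continuous_const|].
  exact (continuous_mult (K := R_AbsRing) _ _ _ Hf IH).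
Qed.

Lemma ex_RInt_continuous_everywhere (f : R -> R) (a b : R) :
  (forall x, continuous f x) -> ex_RInt f a b.
Proof. intros Hf; apply (ex_RInt_continuous (V := R_CompleteNormedModule)); auto. Qed.

Lemma continuous_RInt_upper (f : R -> R) (a x : R) :
  (forall y, continuous f y) -> continuous (fun y => RInt f a y) x.
Proof.
  intros Hf; apply (ex_derive_continuous (V := R_NormedModule)).
  exists (f x); apply (is_derive_RInt (V := R_CompleteNormedModule) f (RInt f a) a x).
  - apply filter_forall; intros y.
    now apply (RInt_correct (V := R_CompleteNormedModule)), ex_RInt_continuous_everywhere.
  - apply Hf.
Qed.

Lemma RInt_sum_f_R0 (F : nat -> R -> R) (d : nat) (a b : R) :
  (forall i x, continuous (F i) x) ->
  RInt (fun x => sum_f_R0 (fun i => F i x) d) a b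
  = sum_f_R0 (fun i => RInt (F i) a b) d.
Proof.
  intros HF; induction d as [|d IH]; simpl; [reflexivity|].
  rewrite <- IH.
  apply (RInt_plus (V := R_CompleteNormedModule)
           (fun x => sum_f_R0 (fun i => F i x) d) (F (S d)));
    apply ex_RInt_continuous_everywhere; auto.
  intros x; apply continuous_sum_f_R0; auto.
Qed.

Lemma sum_f_R0_poly_shift (f : nat -> R) (d : nat) (q : R) :
  sum_f_R0 (fun i => f i * q ^ i) (S d)
  = f 0%nat + q * sum_f_R0 (fun i => f (S i) * q ^ i) d.
Proof.
  induction d as [|d IH]; [simpl; ring|].
  rewrite tech5, IH, (tech5 _ d); simpl; ring.
Qed.

(** The constant term is the limit of the polynomial as [q] tends to 0 from the right, hence 0.
    Dividing the rest by [q > 0] leaves a polynomial of lower degree, to which induction applies. *)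
Lemma poly_coeffs_eq_0 (f : nat -> R) (d : nat) :
  (forall q, 0 < q < 1 -> sum_f_R0 (fun i => f i * q ^ i) d = 0) ->
  forall i, (i <= d)%nat -> f i = 0.
Proof.
  revert f; induction d as [|d IH]; intros f Hf.
  - intros i Hi; replace i with 0%nat by lia.
    specialize (Hf (1 / 2) ltac:(lra)); simpl in Hf; lra.
  - set (P := fun q => sum_f_R0 (fun i => f i * q ^ i) (S d)).
    assert (H0 : f 0%nat = 0).
    { assert (HP : continuous P 0).
      { apply (continuous_sum_f_R0 (fun i q => f i * q ^ i)); intros i.
        apply (continuous_mult (K := R_AbsRing)); [apply continuous_const|].
        apply continuous_Rpow, continuous_id. }
      assert (HP0 : P 0 = f 0%nat).
      { unfold P; rewrite sum_f_R0_poly_shift; ring. }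
      rewrite <- HP0.
      (* Limits along [at_right 0] are unique: continuity gives the limit [P 0], vanishing on
         [(0, 1)] gives the limit 0. *)
      refine (filterlim_locally_unique (F := at_right 0) P _ _ _ _).
      - apply (filterlim_filter_le_1 (F := locally 0) (G := at_right 0) P);
          [apply filter_le_within|exact HP].
      - apply (filterlim_ext_loc (fun _ => 0)); [|apply filterlim_const].
        exists (mkposreal 1 Rlt_0_1); intros y Hy Hy0; symmetry; apply Hf.
        change (Rabs (y - 0) < 1) in Hy; apply Rabs_def2 in Hy; lra. }
    intros [|i] Hi; [exact H0|].
    apply (IH (fun i => f (S i))); [|lia].
    intros q Hq; specialize (Hf q Hq).
    rewrite sum_f_R0_poly_shift, H0 in Hf.
    apply (Rmult_eq_reg_l q); lra.
Qed.

Lemma poly_coeffs_unique (f g : nat -> R) (d : nat) :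
  (forall q, 0 < q < 1 ->
     sum_f_R0 (fun i => f i * q ^ i) d = sum_f_R0 (fun i => g i * q ^ i) d) ->
  forall i, (i <= d)%nat -> f i = g i.
Proof.
  intros H i Hi; apply Rminus_diag_uniq.
  apply (poly_coeffs_eq_0 (fun i => f i - g i) d); trivial.
  intros q Hq.
  rewrite (sum_eq _ (fun i => f i * q ^ i - g i * q ^ i)) by (intros; ring).
  rewrite minus_sum, (H q Hq); ring.
Qed.

(** The coefficients in [q] depend on a parameter [s]. They are continuous on the whole line, so
    that every integral exists, but positive only on [D]: an open interval for integrands, a
    half-open one for integrals. Vanishing beyond [d] removes the boundary terms of products. *)
Definition positive_poly_family (D : R -> Prop) (d : nat) (P : R -> R -> R) : Prop :=
  exists a : nat -> R -> R,
    (forall i s, continuous (a i) s) /\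
    (forall i s, (d < i)%nat -> a i s = 0) /\
    (forall i s, (i <= d)%nat -> D s -> 0 < a i s) /\
    (forall q s, P q s = sum_f_R0 (fun i => a i s * q ^ i) d).

Lemma positive_poly_family_continuous D d P q s :
  positive_poly_family D d P -> continuous (P q) s.
Proof.
  intros (a & Hc & _ & _ & HP).
  apply (continuous_ext (fun s => sum_f_R0 (fun i => a i s * q ^ i) d)).
  { intros x; symmetry; apply HP. }
  apply (continuous_sum_f_R0 (fun i s => a i s * q ^ i)); intros i.
  apply (continuous_mult (K := R_AbsRing)); [apply Hc|apply continuous_const].
Qed.

(** The new coefficients are [(1 - s) * a (i-1) s + s * a i s]. For [0 < s < 1] both weights are
    positive, and for [i <= S d] at least one of the two old coefficients is positive while the
    other is positive or absent. *)
Lemma positive_poly_family_mul_affine d P :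
  positive_poly_family (fun s => 0 < s < 1) d P ->
  positive_poly_family (fun s => 0 < s < 1) (S d)
    (fun q s => (q * (1 - s) + s) * P q s).
Proof.
  intros (a & Hc & Hz & Hp & HP).
  exists (fun i s => match i with O => 0 | S j => (1 - s) * a j s end + s * a i s).
  split; [|split; [|split]].
  - intros i s; apply (continuous_plus (V := R_NormedModule)).
    + destruct i as [|j]; [apply continuous_const|].
      apply (continuous_mult (K := R_AbsRing)); [|apply Hc].
      apply (ex_derive_continuous (V := R_NormedModule)); auto_derive; trivial.
    + apply (continuous_mult (K := R_AbsRing)); [apply continuous_id|apply Hc].
  - intros [|i] s Hi; [lia|]; rewrite !Hz by lia; ring.
  - intros [|i] s Hi Hs.
    + specialize (Hp 0%nat s ltac:(lia) Hs); nra.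
    + specialize (Hp i s ltac:(lia) Hs) as H1.
      (* At the top index [S d] only the term [(1 - s) * a d s] survives. *)
      destruct (Nat.eq_dec i d) as [->|Hid].
      * rewrite (Hz (S d)) by lia; nra.
      * specialize (Hp (S i) s ltac:(lia) Hs); nra.
  - intros q s; rewrite HP.
    (* Keeping the last sum up to [S m] makes the identity true for every [m], hence provable by
       induction; at [m = d] its extra term contains [a (S d) s = 0]. *)
    assert (E : forall m,
      sum_f_R0 (fun i =>
        (match i with O => 0 | S j => (1 - s) * a j s end + s * a i s) * q ^ i) (S m)
      = q * (1 - s) * sum_f_R0 (fun i => a i s * q ^ i) m
        + s * sum_f_R0 (fun i => a i s * q ^ i) (S m)).
    { induction m as [|m IH]; [simpl; ring|].
      rewrite tech5, IH, (tech5 _ (S m)), (tech5 _ m); simpl; ring. }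
    rewrite E, (tech5 _ d), (Hz (S d)) by lia; ring.
Qed.

Lemma positive_poly_family_mul_affine_pow d P m :
  positive_poly_family (fun s => 0 < s < 1) d P ->
  positive_poly_family (fun s => 0 < s < 1) (m + d)
    (fun q s => (q * (1 - s) + s) ^ m * P q s).
Proof.
  intros HP; induction m as [|m IH]; simpl.
  - destruct HP as (a & Hc & Hz & Hp & HP); exists a; repeat split; auto.
    intros; rewrite Rmult_1_l; apply HP.
  - destruct (positive_poly_family_mul_affine _ _ IH) as (a & Hc & Hz & Hp & HP').
    exists a; repeat split; auto.
    intros q s; rewrite <- HP'; ring.
Qed.

(** Integration acts on each coefficient separately. Positivity inside [(0, s)] suffices for a
    positive integral, so the endpoint [s = 1] is gained. *)
Lemma positive_poly_family_RInt d P :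
  positive_poly_family (fun s => 0 < s < 1) d P ->
  positive_poly_family (fun s => 0 < s <= 1) d (fun q s => RInt (P q) 0 s).
Proof.
  intros (a & Hc & Hz & Hp & HP).
  exists (fun i s => RInt (a i) 0 s); split; [|split; [|split]].
  - intros i s; apply continuous_RInt_upper; auto.
  - intros i s Hi.
    rewrite (RInt_ext _ (fun _ => 0)) by (intros; apply Hz; lia).
    rewrite RInt_const; apply Rmult_0_r.
  - intros i s Hi Hs; apply RInt_gt_0; [lra| |auto].
    intros x Hx; apply Hp; trivial; lra.
  - intros q s.
    rewrite (RInt_ext _ (fun s => sum_f_R0 (fun i => a i s * q ^ i) d)) by auto.
    rewrite (RInt_sum_f_R0 (fun i s => a i s * q ^ i)).
    + apply sum_eq; intros i _.
      rewrite (RInt_ext _ (fun x => scal (q ^ i) (a i x)))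
        by (intros; apply Rmult_comm).
      rewrite (RInt_scal (V := R_CompleteNormedModule))
        by (apply ex_RInt_continuous_everywhere; auto).
      apply Rmult_comm.
    + intros i x; apply (continuous_mult (K := R_AbsRing));
        [apply Hc|apply continuous_const].
Qed.

(** The iterated integral after rescaling: the domain is the simplex below [s], free of [q], which
    now occurs in the integrand only. *)
Fixpoint normalized_integral (rc : list nat) (q s : R) : R :=
  match rc with
  | nil => 1
  | cons cj rc' =>
      RInt (fun u => (q * (1 - u) + u) ^ (cj - 1) * normalized_integral rc' q u) 0 s
  end.

Lemma normalized_integral_positive (rc : list nat) :
  positive_poly_family (fun s => 0 < s <= 1)
    (list_sum (map (fun ci => ci - 1)%nat rc)) (normalized_integral rc).
Proof.
  induction rc as [|cj rc IH]; cbn [normalized_integral map].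
  - exists (fun i _ => match i with O => 1 | S _ => 0 end); split; [|split; [|split]].
    + intros; apply continuous_const.
    + intros [|i] s Hi; [simpl in Hi; lia|reflexivity].
    + intros [|i] s Hi _; [lra|simpl in Hi; lia].
    + intros; simpl; ring.
  - apply (positive_poly_family_RInt _ (fun q u =>
      (q * (1 - u) + u) ^ (cj - 1) * normalized_integral rc q u)).
    apply positive_poly_family_mul_affine_pow.
    (* The induction hypothesis is restricted from [(0, 1]] to [(0, 1)], where the weight [1 - s] is
       positive. *)
    destruct IH as (a & Hc & Hz & Hp & HP).
    exists a; repeat split; auto.
    intros i s Hi Hs; apply Hp; trivial; lra.
Qed.

(** Each substitution [t = (1 - q) * u + q] contributes one factor [1 - q]. The induction needs
    arbitrary [s] and [w], since both change under the outer integral. *)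
Lemma iterated_integral_normalized (rc : list nat) (q s w : R) :
  q <> 1 ->
  iterated_integral q rc ((1 - q) * s + q) w
  = w * (1 - q) ^ length rc * normalized_integral rc q s.
Proof.
  intros Hq; revert s w; induction rc as [|cj rc IH]; intros s w; simpl; [ring|].
  set (f := fun t => iterated_integral q rc t (t ^ (cj - 1) * w)).
  assert (Hcont : forall u, continuous (normalized_integral rc q) u).
  { intros u; eapply positive_poly_family_continuous, normalized_integral_positive. }
  assert (Hf : forall t, continuous f t).
  { intros t.
    (* Inverting the substitution, possible as [q <> 1], brings every [x] into the form covered by
       [IH]. *)
    apply (continuous_ext (fun t => t ^ (cj - 1) * (w * (1 - q) ^ length rc
             * normalized_integral rc q (/ (1 - q) * t + - q / (1 - q))))).
    { intros x; symmetry; unfold f.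
      replace (iterated_integral q rc x)
        with (iterated_integral q rc ((1 - q) * (/ (1 - q) * x + - q / (1 - q)) + q))
        by (f_equal; field; lra).
      rewrite IH, !Rmult_assoc; reflexivity. }
    apply (continuous_mult (K := R_AbsRing)).
    { apply continuous_Rpow, continuous_id. }
    apply (continuous_mult (K := R_AbsRing)); [apply continuous_const|].
    apply (continuous_comp (fun t => / (1 - q) * t + - q / (1 - q))); [|apply Hcont].
    apply (ex_derive_continuous (V := R_NormedModule)); auto_derive; trivial. }
  (* The lower limit becomes the image of 0 under the substitution. *)
  replace q with ((1 - q) * 0 + q) at 1 by ring.
  rewrite <- (RInt_comp_lin (V := R_CompleteNormedModule) f)
    by (apply ex_RInt_continuous_everywhere; exact Hf).
  rewrite (RInt_ext _ (fun u => scal (w * (1 - q) ^ S (length rc))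
    ((q * (1 - u) + u) ^ (cj - 1) * normalized_integral rc q u))).
  - rewrite (RInt_scal (V := R_CompleteNormedModule)); [reflexivity|].
    apply ex_RInt_continuous_everywhere; intros u.
    apply (continuous_mult (K := R_AbsRing)); [|apply Hcont].
    apply continuous_Rpow, (ex_derive_continuous (V := R_NormedModule)).
    auto_derive; trivial.
  - intros u _; unfold f; rewrite IH.
    replace ((1 - q) * u + q) with (q * (1 - u) + u) by ring.
    unfold scal; simpl; unfold mult; simpl; ring.
Qed.

(** Since all parts are positive, the truncated subtractions are exact; this identifies the degree
    as [n - k]. *)
Lemma list_sum_pred (c : list nat) :
  List.Forall (fun ci => (0 < ci)%nat) c ->
  list_sum (map (fun ci => ci - 1)%nat c) = (list_sum c - length c)%nat /\
  (length c <= list_sum c)%nat.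
Proof.
  induction 1 as [|x c Hx Hc [IH1 IH2]]; simpl; [lia|].
  rewrite IH1; lia.
Qed.

Theorem theorem6p5 (n : nat) (c : list nat) (hc : is_composition c n) :
  (exists f : nat -> R, reduced_composition_coeffs c (n - length c) f) /\
  (forall f : nat -> R, reduced_composition_coeffs c (n - length c) f ->
     forall i : nat, (i <= n - length c)%nat -> 0 < f i).
Proof.
  destruct hc as [Hpos Hsum].
  assert (Hd : list_sum (map (fun ci => ci - 1)%nat (rev c)) = (n - length c)%nat).
  { destruct (list_sum_pred (rev c)) as [-> _]; [now apply Forall_rev|].
    rewrite length_rev, <- Hsum; f_equal.
    clear; induction c as [|x c IH]; simpl; [reflexivity|].
    rewrite list_sum_app, IH; simpl; lia. }
  destruct (normalized_integral_positive (rev c)) as (a & _ & _ & Hp & HP).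
  rewrite Hd in Hp, HP.
  (* The outermost upper limit 1 corresponds to [s = 1]. *)
  assert (Ha : reduced_composition_coeffs c (n - length c) (fun i => a i 1)).
  { intros q Hq; rewrite <- HP.
    unfold reduced_composition_poly, composition_poly.
    replace (iterated_integral q (rev c) 1 1)
      with (iterated_integral q (rev c) ((1 - q) * 1 + q) 1) by (f_equal; ring).
    rewrite iterated_integral_normalized, length_rev by exact Hq.
    field; apply pow_nonzero; lra. }
  split; [now exists (fun i => a i 1)|].
  intros f Hf i Hi.
  (* Agreement on [(0, 1)], which avoids [q = 1], already determines the coefficients. *)
  rewrite (poly_coeffs_unique f (fun i => a i 1) (n - length c)); trivial.
  - apply Hp; trivial; lra.
  - intros q Hq; rewrite <- Hf, <- Ha by lra; reflexivity.
Qed.
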